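(* Let $n\ge2$, let $\epsilon_0,\dots,\epsilon_{n-1}$ be the standard basis of $\mathbb{R}^n$, and let $\Psi=\{\pm4\epsilon_i:0\le i\le n-1\}$. Let $\Delta=\{\alpha''_0,\alpha_1,\dots,\alpha_{n-1},\alpha''_n\}$, where $\alpha''_0=-8\epsilon_0$, $\alpha_i=4(\epsilon_{i-1}-\epsilon_i)$ for $1\le i\le n-1$, and $\alpha''_n=8\epsilon_{n-1}$. (i) The $2n$-dimensional $\mathbb{C}$-vector space $V_\Psi$ has the structure of a $\mathfrak g$-module (via the operators $E_{\mathbf a},F_{\mathbf a},H_{\mathbf a}$, $\mathbf a\in\Delta$), where $\mathfrak g$ is the derived affine Kac--Moody algebra of type $C_n^{(1)}$. (ii) Let $\Psi'=\Psi$ and $\Delta'=\Delta\setminus\{\alpha''_0\}$. Then $\Psi'$ is a minuscule system with respect to the simple system $\Delta'$, and $V_{\Psi'}$ is a module for the simple Lie algebra $\mathfrak c_n$ over $\mathbb{C}$ of type $C_n$. It is an irreducible module with highest weight vector $b_{4\epsilon_0}$ and lowest weight vector $b_{-4\epsilon_0}$, and affords the natural representation of $\mathfrak c_n$.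
   Context: Minuscule systems: $\mathbb{R}^n$ carries the usual scalar product. Let $\Psi,\Delta\subset\mathbb{R}^n$ with $0\notin\Delta$. $\Psi$ is a minuscule system with respect to the simple system $\Delta$ if for every $\mathbf v\in\Psi$ and $\mathbf a\in\Delta$: (i) $2\,\mathbf v\cdot\mathbf a = c\,\mathbf a\cdot\mathbf a$ for some $c=c(\mathbf v,\mathbf a)\in\{-1,0,1\}$; (ii) $\mathbf v+\mathbf a\in\Psi$ if and only if $c=-1$, and $\mathbf v-\mathbf a\in\Psi$ if and only if $c=1$. Operators: $V_\Psi$ is the vector space (here over $\mathbb{C}$) with basis $\{b_{\mathbf v}:\mathbf v\in\Psi\}$. For $\mathbf a\in\Delta$ the linear endomorphisms $E_{\mathbf a},F_{\mathbf a},H_{\mathbf a}$ of $V_\Psi$ are defined by: $E_{\mathbf a}(b_{\mathbf v})=b_{\mathbf v+\mathbf a}$ if $\mathbf v+\mathbf a\in\Psi$ and $0$ otherwise; $F_{\mathbf a}(b_{\mathbf v})=b_{\mathbf v-\mathbf a}$ if $\mathbf v-\mathbf a\in\Psi$ and $0$ otherwise; $H_{\mathbf a}(b_{\mathbf v})=c(\mathbf v,\mathbf a)\,b_{\mathbf v}$. Lie algebras: the generalized Cartan matrix of $\Delta$ is $A_{\mathbf a,\mathbf b}=2\frac{\mathbf a\cdot\mathbf b}{\mathbf a\cdot\mathbf a}$ ($\mathbf a,\mathbf b\in\Delta$). For a symmetrizable generalized Cartan matrix $A$, the derived Kac--Moody algebra $\mathfrak g'(A)$ is the Lie algebra over $\mathbb{C}$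 generated by $e_i,f_i,h_i$ subject to $[h_i,h_j]=0$, $[h_i,e_j]=A_{ij}e_j$, $[h_i,f_j]=-A_{ij}f_j$, $[e_i,f_j]=\delta_{ij}h_i$, and, for $i\ne j$, $(\mathrm{ad}\,e_i)^{1-A_{ij}}(e_j)=0=(\mathrm{ad}\,f_i)^{1-A_{ij}}(f_j)$; when $A$ is an (indecomposable) Cartan matrix of finite type this is the simple Lie algebra of that type. All module structures asserted are those in which the matrix of the indicated simple system is a generalized Cartan matrix of the stated type (types as in Kac's book) and the generators $e_{\mathbf a},f_{\mathbf a},h_{\mathbf a}$ act by $E_{\mathbf a},F_{\mathbf a},H_{\mathbf a}$. A weight vector (simultaneous eigenvector for all $h_i$) is a highest (respectively lowest) weight vector if it is annihilated by all $e_i$ (respectively all $f_i$). The natural representation of $\mathfrak c_n$ is $L(\omega_1)$, the irreducible module (of dimension $2n$) whose highest weight is the fundamental weight $\omega_1$ dual to $h_1$, where $\alpha_1,\dots,\alpha_{n-1},\alpha''_n$ label the simple roots $1,\dots,n$. *)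

(* Defs.v *)
(* MathComp, with the reals taken as an arbitrary realType R and the complex
   numbers as R[i]. *)
From HB Require Import structures.
From mathcomp Require Import all_boot all_order all_algebra.
From mathcomp Require Import generic_quotient finmap complex.
From mathcomp Require Import boolp reals.

Set Implicit Arguments.
Unset Strict Implicit.
Unset Printing Implicit Defensive.

Import Order.TTheory GRing.Theory Num.Theory.

Local Open Scope ring_scope.
Local Open Scope quotient_scope.

HB.mixin Record Lmodule_isLieAlgebra (K : comNzRingType) L
    of GRing.Lmodule K L := {
  lie_bracket : L -> L -> L;
  lie_bracketPl : forall (c : K) (x y z : L),
    lie_bracket (c *: x + y) z = c *: lie_bracket x z + lie_bracket y z;
  lie_bracketPr : forall (c : K) (x y z : L),
    lie_bracket z (c *: x + y) = c *: lie_bracket z x + lie_bracket z y;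
  lie_bracketxx : forall x : L, lie_bracket x x = 0;
  lie_jacobi : forall x y z : L,
    lie_bracket x (lie_bracket y z) + lie_bracket y (lie_bracket z x)
      + lie_bracket z (lie_bracket x y) = 0
}.

#[short(type="lieAlgType")]
HB.structure Definition LieAlgebra (K : comNzRingType) :=
  { L of GRing.Lmodule K L & Lmodule_isLieAlgebra K L }.

Inductive lie_term (K : comNzRingType) (X : Type) : Type :=
| LGen of X
| LZero
| LOpp of lie_term K X
| LAdd of lie_term K X & lie_term K X
| LScale of K & lie_term K X
| LBr of lie_term K X & lie_term K X.

Arguments LGen {K X} _.
Arguments LZero {K X}.
Arguments LOpp {K X} _.
Arguments LAdd {K X} _ _.
Arguments LScale {K X} _ _.
Arguments LBr {K X} _ _.

(* The least congruence on terms that contains P and makes the quotient a Lie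
   algebra over K. *)
Inductive lie_cong (K : comNzRingType) (X : Type)
    (P : lie_term K X -> lie_term K X -> Prop) :
    lie_term K X -> lie_term K X -> Prop :=
| LC_rel s t : P s t -> lie_cong P s t
| LC_refl t : lie_cong P t t
| LC_sym s t : lie_cong P s t -> lie_cong P t s
| LC_trans s t u : lie_cong P s t -> lie_cong P t u -> lie_cong P s u
| LC_opp s t : lie_cong P s t -> lie_cong P (LOpp s) (LOpp t)
| LC_add s s' t t' : lie_cong P s s' -> lie_cong P t t' ->
    lie_cong P (LAdd s t) (LAdd s' t')
| LC_scale c s t : lie_cong P s t -> lie_cong P (LScale c s) (LScale c t)
| LC_br s s' t t' : lie_cong P s s' -> lie_cong P t t' ->
    lie_cong P (LBr s t) (LBr s' t')
| LC_addA s t u : lie_cong P (LAdd s (LAdd t u)) (LAdd (LAdd s t) u)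
| LC_addC s t : lie_cong P (LAdd s t) (LAdd t s)
| LC_add0 t : lie_cong P (LAdd LZero t) t
| LC_addN t : lie_cong P (LAdd (LOpp t) t) LZero
| LC_scaleA c d t :
    lie_cong P (LScale c (LScale d t)) (LScale (c * d) t)
| LC_scale1 t : lie_cong P (LScale 1 t) t
| LC_scaleDr c s t :
    lie_cong P (LScale c (LAdd s t)) (LAdd (LScale c s) (LScale c t))
| LC_scaleDl c d t :
    lie_cong P (LScale (c + d) t) (LAdd (LScale c t) (LScale d t))
| LC_brPl c s t u :
    lie_cong P (LBr (LAdd (LScale c s) t) u)
               (LAdd (LScale c (LBr s u)) (LBr t u))
| LC_brPr c s t u :
    lie_cong P (LBr u (LAdd (LScale c s) t))
               (LAdd (LScale c (LBr u s)) (LBr u t))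
| LC_brxx t : lie_cong P (LBr t t) LZero
| LC_jacobi s t u :
    lie_cong P
      (LAdd (LAdd (LBr s (LBr t u)) (LBr t (LBr u s))) (LBr u (LBr s t)))
      LZero.

Section LiePresentation.
Context (K : comNzRingType) (X : Type).
Context (P : lie_term K X -> lie_term K X -> Prop).

HB.instance Definition _ := gen_eqMixin (lie_term K X).
HB.instance Definition _ := gen_choiceMixin (lie_term K X).

Definition lie_congb (s t : lie_term K X) : bool := `[< lie_cong P s t >].

Fact lie_congb_refl : reflexive lie_congb.
Proof. by move=> t; apply/asboolP; exact: LC_refl. Qed.

Fact lie_congb_sym : symmetric lie_congb.
Proof. by move=> s t; apply/asboolP/asboolP; exact: LC_sym. Qed.

Fact lie_congb_trans : transitive lie_congb.
Proof.
by move=> t s u /asboolP st /asboolP tu; apply/asboolP; exact: LC_trans tu.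
Qed.

Canonical lie_congb_equiv :=
  EquivRel lie_congb lie_congb_refl lie_congb_sym lie_congb_trans.

Definition lie_presented := {eq_quot lie_congb_equiv}.

HB.instance Definition _ := Choice.on lie_presented.
HB.instance Definition _ := EqQuotient.on lie_presented.

Local Notation Q := lie_presented.

Lemma lie_piP (s t : lie_term K X) :
  (\pi_Q s = \pi_Q t) <-> lie_cong P s t.
Proof.
split; first by move=> /eqquotP /asboolP.
by move=> st; apply/eqquotP/asboolP.
Qed.

Lemma lie_repr_pi (t : lie_term K X) : lie_cong P (repr (\pi_Q t)) t.
Proof. by apply/lie_piP; rewrite reprK. Qed.

Definition lp_zero : Q := \pi_Q LZero.
Definition lp_opp (x : Q) : Q := \pi_Q (LOpp (repr x)).
Definition lp_add (x y : Q) : Q := \pi_Q (LAdd (repr x) (repr y)).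
Definition lp_scale (c : K) (x : Q) : Q := \pi_Q (LScale c (repr x)).
Definition lp_br (x y : Q) : Q := \pi_Q (LBr (repr x) (repr y)).

Lemma lp_oppE t : lp_opp (\pi_Q t) = \pi_Q (LOpp t).
Proof. by apply/lie_piP/LC_opp/lie_repr_pi. Qed.

Lemma lp_addE s t : lp_add (\pi_Q s) (\pi_Q t) = \pi_Q (LAdd s t).
Proof. by apply/lie_piP/LC_add; exact: lie_repr_pi. Qed.

Lemma lp_scaleE c t : lp_scale c (\pi_Q t) = \pi_Q (LScale c t).
Proof. by apply/lie_piP/LC_scale/lie_repr_pi. Qed.

Lemma lp_brE s t : lp_br (\pi_Q s) (\pi_Q t) = \pi_Q (LBr s t).
Proof. by apply/lie_piP/LC_br; exact: lie_repr_pi. Qed.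

Fact lp_addA : associative lp_add.
Proof.
elim/quotW=> s; elim/quotW=> t; elim/quotW=> u.
by rewrite (lp_addE t u) (lp_addE s t) !lp_addE; apply/lie_piP; exact: LC_addA.
Qed.

Fact lp_addC : commutative lp_add.
Proof.
by elim/quotW=> s; elim/quotW=> t; rewrite !lp_addE; apply/lie_piP; exact: LC_addC.
Qed.

Fact lp_add0 : left_id lp_zero lp_add.
Proof. by elim/quotW=> t; rewrite lp_addE; apply/lie_piP; exact: LC_add0. Qed.

Fact lp_addN : left_inverse lp_zero lp_opp lp_add.
Proof. by elim/quotW=> t; rewrite lp_oppE lp_addE; apply/lie_piP; exact: LC_addN. Qed.

HB.instance Definition _ :=
  GRing.isZmodule.Build Q lp_addA lp_addC lp_add0 lp_addN.

Fact lp_scaleA c d x : lp_scale c (lp_scale d x) = lp_scale (c * d) x.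
Proof.
by elim/quotW: x => t; rewrite (lp_scaleE d) !lp_scaleE; apply/lie_piP;
exact: LC_scaleA.
Qed.

Fact lp_scale1 : left_id 1 lp_scale.
Proof. by elim/quotW=> t; rewrite lp_scaleE; apply/lie_piP; exact: LC_scale1. Qed.

Fact lp_scaleDr : right_distributive lp_scale +%R.
Proof.
move=> c; elim/quotW=> s; elim/quotW=> t; rewrite /GRing.add /=.
rewrite (lp_addE s t) (lp_scaleE c s) (lp_scaleE c t) lp_scaleE lp_addE.
by apply/lie_piP; exact: LC_scaleDr.
Qed.

Fact lp_scaleDl x : {morph lp_scale^~ x : c d / c + d}.
Proof.
move=> c d; elim/quotW: x => t; rewrite [RHS]/GRing.add /=.
rewrite (lp_scaleE c) (lp_scaleE d) lp_scaleE lp_addE.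
by apply/lie_piP; exact: LC_scaleDl.
Qed.

HB.instance Definition _ :=
  GRing.Zmodule_isLmodule.Build K Q lp_scaleA lp_scale1 lp_scaleDr lp_scaleDl.

Lemma lie_pi0 : \pi_Q LZero = 0 :> Q.
Proof. by []. Qed.

Lemma lie_piN t : \pi_Q (LOpp t) = - \pi_Q t :> Q.
Proof. by rewrite -lp_oppE. Qed.

Lemma lie_piD s t : \pi_Q (LAdd s t) = \pi_Q s + \pi_Q t :> Q.
Proof. by rewrite -lp_addE. Qed.

Lemma lie_piZ c t : \pi_Q (LScale c t) = c *: \pi_Q t :> Q.
Proof. by rewrite -lp_scaleE. Qed.

Fact lp_brPl (c : K) (x y z : Q) :
  lp_br (c *: x + y) z = c *: lp_br x z + lp_br y z.
Proof.
elim/quotW: x => s; elim/quotW: y => t; elim/quotW: z => u.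
rewrite -lie_piZ -lie_piD (lp_brE s u) (lp_brE t u) lp_brE -lie_piZ -lie_piD.
by apply/lie_piP; exact: LC_brPl.
Qed.

Fact lp_brPr (c : K) (x y z : Q) :
  lp_br z (c *: x + y) = c *: lp_br z x + lp_br z y.
Proof.
elim/quotW: x => s; elim/quotW: y => t; elim/quotW: z => u.
rewrite -lie_piZ -lie_piD (lp_brE u s) (lp_brE u t) lp_brE -lie_piZ -lie_piD.
by apply/lie_piP; exact: LC_brPr.
Qed.

Fact lp_brxx (x : Q) : lp_br x x = 0.
Proof.
by elim/quotW: x => t; rewrite lp_brE -lie_pi0; apply/lie_piP; exact: LC_brxx.
Qed.

Fact lp_jacobi (x y z : Q) :
  lp_br x (lp_br y z) + lp_br y (lp_br z x) + lp_br z (lp_br x y) = 0.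
Proof.
elim/quotW: x => s; elim/quotW: y => t; elim/quotW: z => u.
rewrite (lp_brE t u) (lp_brE u s) (lp_brE s t) !lp_brE -!lie_piD -lie_pi0.
by apply/lie_piP; exact: LC_jacobi.
Qed.

HB.instance Definition _ :=
  Lmodule_isLieAlgebra.Build K Q lp_brPl lp_brPr lp_brxx lp_jacobi.

Lemma lie_piBr s t : \pi_Q (LBr s t) = lie_bracket (\pi_Q s) (\pi_Q t) :> Q.
Proof. by rewrite -lp_brE. Qed.

End LiePresentation.

Definition gcm (m : nat) (A : 'M[int]_m) : Prop :=
  [/\ forall i, A i i = 2,
      forall i j, i != j -> A i j <= 0
    & forall i j, A i j = 0 -> A j i = 0].

(* A = D B with D an invertible diagonal matrix and B symmetric. *)
Definition symmetrizable (m : nat) (A : 'M[int]_m) : Prop :=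
  exists (D : 'rV[rat]_m) (B : 'M[rat]_m),
    [/\ diag_mx D \in unitmx, B^T = B & map_mx intr A = diag_mx D *m B].

Inductive km_gen (m : nat) : Type :=
| KMe of 'I_m
| KMf of 'I_m
| KMh of 'I_m.

Section KacMoody.
Context (K : comNzRingType) (m : nat) (A : 'M[int]_m).

Local Notation te i := (LGen (KMe i) : lie_term K (km_gen m)).
Local Notation tf i := (LGen (KMf i) : lie_term K (km_gen m)).
Local Notation th i := (LGen (KMh i) : lie_term K (km_gen m)).

(* For a generalized Cartan matrix, `|1 - A i j|%N is 1 - A i j as soon as
   i != j. *)
Inductive km_rel : lie_term K (km_gen m) -> lie_term K (km_gen m) -> Prop :=
| KM_hh i j : km_rel (LBr (th i) (th j)) LZero
| KM_he i j : km_rel (LBr (th i) (te j)) (LScale (A i j)%:~R (te j))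
| KM_hf i j : km_rel (LBr (th i) (tf j)) (LScale (- (A i j)%:~R) (tf j))
| KM_ef i : km_rel (LBr (te i) (tf i)) (th i)
| KM_ef0 i j : i != j -> km_rel (LBr (te i) (tf j)) LZero
| KM_serre_e i j : i != j ->
    km_rel (iter `|1 - A i j|%N (LBr (te i)) (te j)) LZero
| KM_serre_f i j : i != j ->
    km_rel (iter `|1 - A i j|%N (LBr (tf i)) (tf j)) LZero.

Definition kac_moody : Type := lie_presented km_rel.

HB.instance Definition _ := LieAlgebra.on kac_moody.

Definition km_e (i : 'I_m) : kac_moody := \pi_(lie_presented km_rel) (te i).
Definition km_f (i : 'I_m) : kac_moody := \pi_(lie_presented km_rel) (tf i).
Definition km_h (i : 'I_m) : kac_moody := \pi_(lie_presented km_rel) (th i).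

End KacMoody.

Section Modules.
Context (K : fieldType) (V : vectType K).

(* A module structure on V: a Lie algebra morphism L -> gl(V). *)
Definition lie_module (L : lieAlgType K) (rho : {linear L -> 'End(V)}) : Prop :=
  forall x y : L,
    rho (lie_bracket x y) = (rho x \o rho y)%VF - (rho y \o rho x)%VF.

Definition lie_irreducible (L : lieAlgType K) (rho : {linear L -> 'End(V)}) :
    Prop :=
  (fullv : {vspace V}) <> 0%VS /\
  forall W : {vspace V}, (forall x : L, (rho x @: W <= W)%VS) ->
    W = 0%VS \/ W = fullv.

Context (m : nat) (A : 'M[int]_m).
Context (rho : {linear kac_moody K A -> 'End(V)}).

Definition weight_vector (lam : 'I_m -> K) (v : V) : Prop :=
  v != 0 /\ forall i, rho (km_h K A i) v = lam i *: v.

Definition highest_weight_vector (lam : 'I_m -> K) (v : V) : Prop :=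
  weight_vector lam v /\ forall i, rho (km_e K A i) v = 0.

Definition lowest_weight_vector (lam : 'I_m -> K) (v : V) : Prop :=
  weight_vector lam v /\ forall i, rho (km_f K A i) v = 0.

(* V is the module L(lam). *)
Definition affords_irr_highest_weight (lam : 'I_m -> K) : Prop :=
  lie_irreducible rho /\ exists v, highest_weight_vector lam v.

End Modules.

(* The nodes of the Dynkin diagram are numbered from 1, the node k being the
   index k - 1 of 'I_m. *)
Definition fundamental_weight (K : fieldType) (m k : nat) : 'I_m -> K :=
  fun i => (i.+1 == k)%:R.

Section Minuscule.
Context (R : realType) (n : nat).
Implicit Types (v a : 'rV[R]_n).

Definition dotv v a : R := \sum_i v 0 i * a 0 i.

Definition minuscule (Psi Delta : {fset 'rV[R]_n}) : Prop :=
  0 \notin Delta /\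
  forall v a, v \in Psi -> a \in Delta ->
    exists c : R,
      [/\ c = -1 \/ c = 0 \/ c = 1,
          2 * dotv v a = c * dotv a a,
          v + a \in Psi <-> c = -1
        & v - a \in Psi <-> c = 1].

(* For a != 0 this is the only c such that 2 v.a = c a.a. *)
Definition minc v a : R := 2 * dotv v a / dotv a a.

Definition cartan_mx m (a : 'I_m -> 'rV[R]_n) : 'M[R]_m :=
  \matrix_(i, j) (2 * dotv (a i) (a j) / dotv (a i) (a i)).

Context (Psi : {fset 'rV[R]_n}).

Definition Vspace : vectType R[i] := {ffun Psi -> R[i]^o}.

(* The basis vector b_v for v \in Psi, and 0 otherwise. *)
Definition bvec v : Vspace := [ffun u : Psi => (val u == v)%:R].

Definition lin_ext_fun (g : Psi -> Vspace) (x : Vspace) : Vspace :=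
  \sum_(u : Psi) (x : {ffun Psi -> R[i]^o}) u *: g u.

Fact lin_ext_fun_is_linear g : linear (lin_ext_fun g).
Proof.
move=> c x y; rewrite /lin_ext_fun scaler_sumr -big_split /=.
by apply: eq_bigr => u _; rewrite !ffunE scalerDl scalerA.
Qed.

HB.instance Definition _ g :=
  GRing.isLinear.Build R[i] Vspace Vspace _ (lin_ext_fun g)
    (lin_ext_fun_is_linear g).

(* The endomorphism of Vspace that maps b_u to g u. *)
Definition lin_ext (g : Psi -> Vspace) : 'End(Vspace) :=
  linfun (lin_ext_fun g).

Definition opE a : 'End(Vspace) := lin_ext (fun u =>
  if val u + a \in Psi then bvec (val u + a) else 0).

Definition opF a : 'End(Vspace) := lin_ext (fun u =>
  if val u - a \in Psi then bvec (val u - a) else 0).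

Definition opH a : 'End(Vspace) := lin_ext (fun u =>
  (minc (val u) a)%:C%C *: bvec (val u)).

Definition acts_by_operators m (A : 'M[int]_m) (a : 'I_m -> 'rV[R]_n)
    (rho : {linear kac_moody R[i] A -> 'End(Vspace)}) : Prop :=
  forall i, [/\ rho (km_e R[i] A i) = opE (a i),
                rho (km_f R[i] A i) = opF (a i)
              & rho (km_h R[i] A i) = opH (a i)].

End Minuscule.

(* Kac's numbering 0, ..., n, with diagram 0 => 1 - ... - n-1 <= n (n >= 2). *)
Definition cartan_C_affine (n : nat) : 'M[int]_n.+1 :=
  \matrix_(i, j)
    if i == j then 2
    else if i.+1 == j :> nat then if j == n :> nat then -2 else -1
    else if i == j.+1 :> nat then if j == 0 :> nat then -2 else -1
    else 0.

(* Kac's diagram 1 - ... - n-1 <= n (n >= 2), the node k being the index k - 1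
   of 'I_n. *)
Definition cartan_C (n : nat) : 'M[int]_n :=
  \matrix_(i, j)
    if i == j then 2
    else if i.+1 == j :> nat then if j.+1 == n then -2 else -1
    else if i == j.+1 :> nat then -1
    else 0.

(* V is the module L(omega_1), of dimension 2n. *)
Definition affords_natural_C (K : fieldType) (V : vectType K) (n : nat)
    (rho : {linear kac_moody K (cartan_C n) -> 'End(V)}) : Prop :=
  \dim {:V} = (2 * n)%N /\
  affords_irr_highest_weight rho (fundamental_weight K 1).

Section SystemC.
Context (R : realType) (n : nat).

Definition eps (i : nat) : 'rV[R]_n := \row_j (j == i :> nat)%:R.

Definition PsiC : {fset 'rV[R]_n} :=
  ([fset 4 *: eps i | i : 'I_n in 'I_n] `|` [fset - (4 *: eps i) | i : 'I_n in 'I_n])%fset.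

Definition alpha''0 : 'rV[R]_n := - (8 *: eps 0).
Definition alpha (i : nat) : 'rV[R]_n := 4 *: (eps i.-1 - eps i).
Definition alpha''n : 'rV[R]_n := 8 *: eps n.-1.

Definition simpleC_affine (i : 'I_n.+1) : 'rV[R]_n :=
  if i == 0 :> nat then alpha''0
  else if i == n :> nat then alpha''n
  else alpha i.

(* lift ord0 i ranges over the indices 1, ..., n, so that simpleC enumerates
   DeltaC. *)
Definition simpleC (i : 'I_n) : 'rV[R]_n := simpleC_affine (lift ord0 i).

Definition DeltaC_affine : {fset 'rV[R]_n} :=
  [fset simpleC_affine i | i in 'I_n.+1]%fset.

Definition DeltaC : {fset 'rV[R]_n} := (DeltaC_affine `\ alpha''0)%fset.

End SystemC.

(* Main.v *)
Require Import Defs.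
From HB Require Import structures.
From mathcomp Require Import all_boot all_order all_algebra.
From mathcomp Require Import generic_quotient finmap complex lra zify.
From mathcomp Require Import boolp reals.

Set Implicit Arguments.
Unset Strict Implicit.
Unset Printing Implicit Defensive.

Import Order.TTheory GRing.Theory Num.Theory.

Local Open Scope ring_scope.

(** The set of the vectors +-4 e_k is stable under the reflections in all the
    roots of Delta, and all its vectors have the same norm; a vector v + a then
    lies in it exactly when it is the reflection of v in a, so the set is
    minuscule for the affine system, hence for every subset of it.

    For any minuscule system, the operators satisfy the defining relations of
    the Kac-Moody algebra. Let c(v, a) = 2 v.a / a.a. As E_a moves b_v only if
    c(v, a) = -1, and c(v + a, b) = c(v, b) + c(a, b), each relation becomes a
    comparison of values of c, all of which lie in {-1, 0, 1}. In particular
    E_a E_a = 0, because c(v + a, a) = 1 when c(v, a) = -1. Hence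
    (ad E_a)^2 E_b = -2 E_a E_b E_a and (ad E_a)^3 E_b = 0, which leaves the
    Serre relations with A_ab = 0, where E_a and E_b commute, and A_ab = -1,
    where E_a E_b E_a = 0. The relations for F follow, since F_a is E_(-a).
    A linear map that satisfies the relations on generators factors through
    the presented Lie algebra (lie_presented_universal), which gives the module
    (minuscule_module).

    For irreducibility, order the basis by height: the finite simple roots
    join the 2n vectors of Psi in a single chain

      4 e_0, 4 e_1, ..., 4 e_(n-1), -4 e_(n-1), ..., -4 e_1, -4 e_0

    in which, for these roots a, every E_a moves a basis vector one step to the
    left or kills it, and every F_a moves it one step to the right or kills it. In a nonzero vector of an invariant
    subspace, take a term of largest height and raise it along the chain to the
    top: all the terms of smaller height die on the way, so b_(4 e_0) lies in
    the subspace; lowering it yields the whole basis (invariant_full). The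
    weight of b_(4 e_0) is c(4 e_0, a_i), which is 1 for i = 1 and 0 otherwise,
    that is omega_1. *)

(** * Lie algebra morphisms from a presentation *)

Section LiePresentedUniversal.
Local Open Scope quotient_scope.
Context (K : comNzRingType) (X : Type).
Context (P : lie_term K X -> lie_term K X -> Prop).
Context (L : lieAlgType K) (phi : X -> L).

(** The value of a Lie term when the generators are interpreted by phi. *)
Fixpoint lie_eval (t : lie_term K X) : L :=
  match t with
  | LGen x => phi x
  | LZero => 0
  | LOpp s => - lie_eval s
  | LAdd s u => lie_eval s + lie_eval u
  | LScale c s => c *: lie_eval s
  | LBr s u => lie_bracket (lie_eval s) (lie_eval u)
  end.

Context (lie_evalP : forall s t, P s t -> lie_eval s = lie_eval t).

Lemma lie_eval_cong s t : lie_cong P s t -> lie_eval s = lie_eval t.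
Proof.
elim=> {s t} //=.
- by move=> s t u _ -> _ ->.
- by move=> s t _ ->.
- by move=> s s' t t' _ -> _ ->.
- by move=> c s t _ ->.
- by move=> s s' t t' _ -> _ ->.
- by move=> s t u; rewrite addrA.
- by move=> s t; rewrite addrC.
- by move=> t; rewrite add0r.
- by move=> t; rewrite addNr.
- by move=> c d t; rewrite scalerA.
- by move=> t; rewrite scale1r.
- by move=> c s t; rewrite scalerDr.
- by move=> c d t; rewrite scalerDl.
- by move=> c s t u; rewrite lie_bracketPl.
- by move=> c s t u; rewrite lie_bracketPr.
- by move=> t; rewrite lie_bracketxx.
- by move=> s t u; rewrite lie_jacobi.
Qed.

(** The map induced on the quotient; it does not depend on the representative
    chosen, by lie_lift_pi. *)
Definition lie_lift (x : lie_presented P) : L := lie_eval (repr x).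

Lemma lie_lift_pi t : lie_lift (\pi_(lie_presented P) t) = lie_eval t.
Proof. exact/lie_eval_cong/lie_repr_pi. Qed.

Fact lie_lift_is_linear : linear lie_lift.
Proof.
move=> c x y; elim/quotW: x => s; elim/quotW: y => t.
by rewrite -lie_piZ -lie_piD !lie_lift_pi.
Qed.

(** The universal property of a presentation: an interpretation of the
    generators that satisfies the relations extends to a Lie morphism. *)
Lemma lie_presented_universal :
  exists f : {linear lie_presented P -> L},
    (forall x y, f (lie_bracket x y) = lie_bracket (f x) (f y)) /\
    forall x, f (\pi_(lie_presented P) (LGen x)) = phi x.
Proof.
pose f : {linear lie_presented P -> L} := HB.pack lie_lift
  (GRing.isLinear.Build K (lie_presented P) L _ lie_lift lie_lift_is_linear).
exists f; split=> [x y|x]; last exact: lie_lift_pi.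
elim/quotW: x => s; elim/quotW: y => t.
by rewrite -lie_piBr [LHS]lie_lift_pi [f _]lie_lift_pi [f _]lie_lift_pi.
Qed.

End LiePresentedUniversal.

(** * The general linear Lie algebra *)

Section GeneralLinear.
Context (K : fieldType) (V : vectType K).
Implicit Types f g h : 'End(V).

(** The bracket of gl(V), which makes the endomorphisms of V a Lie algebra. *)
Definition commutator f g : 'End(V) := (f \o g)%VF - (g \o f)%VF.

Fact commutatorPl (c : K) f g h :
  commutator (c *: f + g) h = c *: commutator f h + commutator g h.
Proof.
rewrite /commutator comp_lfunDl comp_lfunDr -comp_lfunZl -comp_lfunZr.
by rewrite scalerBr opprD addrACA.
Qed.

Fact commutatorPr (c : K) f g h :
  commutator h (c *: f + g) = c *: commutator h f + commutator h g.
Proof.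
rewrite /commutator comp_lfunDl comp_lfunDr -comp_lfunZl -comp_lfunZr.
by rewrite scalerBr opprD addrACA.
Qed.

Fact commutatorxx f : commutator f f = 0.
Proof. exact: subrr. Qed.

Lemma commutator2E f g h :
  commutator f (commutator g h) =
    ((f \o g \o h) - (f \o h \o g))%VF + ((h \o g \o f) - (g \o h \o f))%VF.
Proof.
rewrite /commutator comp_lfunDl comp_lfunDr comp_lfunNl comp_lfunNr.
by rewrite opprB !comp_lfunA.
Qed.

Fact commutator_jacobi f g h :
  commutator f (commutator g h) + commutator g (commutator h f)
    + commutator h (commutator f g) = 0.
Proof.
(* Each of the six triple products occurs twice, with opposite signs; the
   summands are reordered so that they telescope. *)
rewrite !commutator2E [X in _ + X + _]addrC [X in X + _]addrACA !subrKA.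
by rewrite addrACA !subrKA subrr.
Qed.

HB.instance Definition _ := Lmodule_isLieAlgebra.Build K 'End(V)
  commutatorPl commutatorPr commutatorxx commutator_jacobi.

End GeneralLinear.

Section KacMoodyModule.
Context (K : fieldType) (V : vectType K) (m : nat) (A : 'M[int]_m).
Context (E F H : 'I_m -> 'End(V)).

(** A module over the derived Kac-Moody algebra is a triple of families of
    endomorphisms that satisfies its defining relations. *)
Lemma kac_moody_module :
  (forall i j, lie_bracket (H i) (H j) = 0) ->
  (forall i j, lie_bracket (H i) (E j) = (A i j)%:~R *: E j) ->
  (forall i j, lie_bracket (H i) (F j) = - (A i j)%:~R *: F j) ->
  (forall i, lie_bracket (E i) (F i) = H i) ->
  (forall i j, i != j -> lie_bracket (E i) (F j) = 0) ->
  (forall i j, i != j -> iter `|1 - A i j|%N (lie_bracket (E i)) (E j) = 0) ->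
  (forall i j, i != j -> iter `|1 - A i j|%N (lie_bracket (F i)) (F j) = 0) ->
  exists rho : {linear kac_moody K A -> 'End(V)},
    lie_module rho /\
    forall i, [/\ rho (km_e K A i) = E i, rho (km_f K A i) = F i
                & rho (km_h K A i) = H i].
Proof.
move=> hh he hf ef ef0 se sf.
pose phi x := match x with KMe i => E i | KMf i => F i | KMh i => H i end.
have evalK t s k : lie_eval phi (iter k (LBr t) s) =
    iter k (lie_bracket (lie_eval phi t)) (lie_eval phi s).
  by elim: k => //= k ->.
have [|rho [rhoM rhoX]] := @lie_presented_universal K _ (km_rel A) _ phi.
  move=> s t [] /=.
  - exact: hh.
  - exact: he.
  - exact: hf.
  - exact: ef.
  - exact: ef0.
  - by move=> i j ij; rewrite evalK; exact: se.
  - by move=> i j ij; rewrite evalK; exact: sf.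
by exists rho; split=> // i; split; exact: rhoX.
Qed.

End KacMoodyModule.

(** * Minuscule systems *)

Section DotProduct.
Context (R : realType) (n : nat).
Implicit Types u v w a : 'rV[R]_n.

Lemma dotvC v w : dotv v w = dotv w v.
Proof. by apply: eq_bigr => i _; rewrite mulrC. Qed.

Lemma dotvDl u v w : dotv (u + v) w = dotv u w + dotv v w.
Proof. by rewrite -big_split; apply: eq_bigr => i _; rewrite mxE mulrDl. Qed.

Lemma dotvNl v w : dotv (- v) w = - dotv v w.
Proof. by rewrite -sumrN; apply: eq_bigr => i _; rewrite mxE mulNr. Qed.

Lemma dotvBl u v w : dotv (u - v) w = dotv u w - dotv v w.
Proof. by rewrite dotvDl dotvNl. Qed.

Lemma dotvZl c v w : dotv (c *: v) w = c * dotv v w.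
Proof. by rewrite mulr_sumr; apply: eq_bigr => i _; rewrite mxE mulrA. Qed.

Lemma dotvDr u v w : dotv w (u + v) = dotv w u + dotv w v.
Proof. by rewrite !(dotvC w) dotvDl. Qed.

Lemma dotvNr v w : dotv w (- v) = - dotv w v.
Proof. by rewrite !(dotvC w) dotvNl. Qed.

Lemma dotvBr u v w : dotv w (u - v) = dotv w u - dotv w v.
Proof. by rewrite dotvDr dotvNr. Qed.

Lemma dotvZr c v w : dotv w (c *: v) = c * dotv w v.
Proof. by rewrite !(dotvC w) dotvZl. Qed.

Lemma dotvv_eq0 v : (dotv v v == 0) = (v == 0).
Proof.
apply/eqP/eqP => [v0|->]; last by apply: big1 => i _; rewrite mxE mul0r.
apply/rowP => i; rewrite mxE; apply/eqP; rewrite -sqrf_eq0 expr2.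
by apply/eqP/(psumr_eq0P _ v0) => // j _; rewrite -expr2 sqr_ge0.
Qed.

Lemma mincD u v a : minc (u + v) a = minc u a + minc v a.
Proof. by rewrite /minc dotvDl mulrDr mulrDl. Qed.

Lemma mincN v a : minc (- v) a = - minc v a.
Proof. by rewrite /minc dotvNl mulrN mulNr. Qed.

Lemma minc_self a : a != 0 -> minc a a = 2.
Proof. by rewrite -dotvv_eq0 => a0; rewrite /minc mulfK. Qed.

Lemma minuscule_sub (Psi Delta Delta' : {fset 'rV[R]_n}) :
  (Delta' `<=` Delta)%fset -> minuscule Psi Delta -> minuscule Psi Delta'.
Proof.
move=> /fsubsetP sub [D0 min]; split; first by apply: contra D0; exact: sub.
by move=> v a vP /sub; exact: min.
Qed.

End DotProduct.

Section Minuscule.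
Context (R : realType) (n : nat) (Psi : {fset 'rV[R]_n}).
Implicit Types v a : 'rV[R]_n.

(** The three possibilities for the number c(v, a) and for the memberships of
    v + a and v - a in Psi. *)
Variant minuscule_spec : R -> bool -> bool -> Prop :=
| MinusculeRaise : minuscule_spec (-1) true false
| MinusculeFix : minuscule_spec 0 false false
| MinusculeLower : minuscule_spec 1 false true.

(** The condition that a minuscule system imposes on one vector a of Delta. It
    is invariant under a |-> - a, which exchanges raising and lowering. *)
Definition minuscule_root a : Prop := a != 0 /\
  forall v, v \in Psi ->
    minuscule_spec (minc v a) (v + a \in Psi) (v - a \in Psi).

Lemma minuscule_rootP Delta a :
  minuscule Psi Delta -> a \in Delta -> minuscule_root a.
Proof.
case=> D0 minP aD; have a0 : a != 0 by apply: contraTneq aD => ->.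
split=> // v vP; have [c [cE va up down]] := minP v a vP aD.
have -> : minc v a = c by rewrite /minc va mulfK ?dotvv_eq0.
have -> : (v + a \in Psi) = (c == -1) by apply/idP/eqP => /up.
have -> : (v - a \in Psi) = (c == 1) by apply/idP/eqP => /down.
by case: cE => [|[|]] ->; do 2!case: eqP => ?; (constructor || (exfalso; lra)).
Qed.

Lemma mincNr v a : minc v (- a) = - minc v a.
Proof. by rewrite /minc !(dotvNl, dotvNr) opprK mulrN mulNr. Qed.

Lemma minuscule_rootN a : minuscule_root a -> minuscule_root (- a).
Proof.
move=> [a0 aP]; split=> [|v /aP]; first by rewrite oppr_eq0.
rewrite mincNr opprK => -[]; rewrite ?opprK ?oppr0; constructor.
Qed.

Lemma minuscule_raise a v : minuscule_root a -> v \in Psi ->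
  (v + a \in Psi) = (minc v a == -1).
Proof.
move=> [_ aP] /aP[]; rewrite ?eqxx //; apply/esym/eqP; lra.
Qed.

End Minuscule.

(** * The module of a minuscule system *)

(** The space with basis indexed by Psi is described by what the arguments need:
    a spanning family b_v, with b_v = 0 for v outside Psi so that no case
    distinction is needed in the formula for the operators E and H; iota maps the
    real numbers c(v, a) to scalars. *)
Section MinusculeOperators.
Context (R : realType) (n : nat) (Psi : {fset 'rV[R]_n}).
Context (K : fieldType) (iota : {rmorphism R -> K}) (V : vectType K).
Context (b : 'rV[R]_n -> V) (E H : 'rV[R]_n -> 'End(V)).
Context (b_notin : forall v, v \notin Psi -> b v = 0).
Context (b_span : forall x : V,
  exists c : Psi -> K, x = \sum_(u : Psi) c u *: b (val u)).
Context (E_b : forall a v, v \in Psi -> E a (b v) = b (v + a)).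
Context (H_b : forall a v, H a (b v) = iota (minc v a) *: b v).
Implicit Types v a : 'rV[R]_n.
Local Notation F := (fun a => E (- a)).

Lemma b_ext (f g : 'End(V)) :
  (forall v, v \in Psi -> f (b v) = g (b v)) -> f = g.
Proof.
move=> fg; apply/lfunP => x; have [c ->] := b_span x; rewrite !linear_sum.
by apply: eq_bigr => u _; rewrite !linearZ /= fg //; exact: valP.
Qed.

Lemma E_raise a v : minuscule_root Psi a -> v \in Psi ->
  E a (b v) = if minc v a == -1 then b (v + a) else 0.
Proof.
move=> aP vP; rewrite E_b // -(minuscule_raise aP vP).
by case: ifPn => // /b_notin.
Qed.

(** A product of two operators is decided by the numbers c alone, because
    c(v + a', a) = c(v, a) + c(a', a). *)
Lemma EE_raise a a' v :
  minuscule_root Psi a -> minuscule_root Psi a' -> v \in Psi ->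
  E a (E a' (b v)) =
    if (minc v a' == -1) && (minc v a + minc a' a == -1)
    then b (v + a' + a) else 0.
Proof.
move=> aP a'P vP; rewrite [E a' _]E_raise //.
case: ifPn => v1; last by rewrite linear0.
by rewrite E_raise -?mincD // minuscule_raise.
Qed.

Lemma bracket_HH a a' : lie_bracket (H a) (H a') = 0.
Proof.
apply: b_ext => v vP.
rewrite [lie_bracket _ _]/(commutator _ _) !(add_lfunE, opp_lfunE, comp_lfunE).
by rewrite !(H_b, linearZ) /= !H_b scalerN !scalerA mulrC subrr lfunE.
Qed.

Lemma bracket_HE a a' :
  lie_bracket (H a) (E a') = iota (minc a' a) *: E a'.
Proof.
apply: b_ext => v vP.
rewrite [lie_bracket _ _]/(commutator _ _) !(add_lfunE, opp_lfunE, comp_lfunE).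
rewrite scale_lfunE H_b linearZ /= E_b // H_b -scalerBl mincD.
by rewrite rmorphD /= addrC addKr.
Qed.

Lemma bracket_HF a a' :
  lie_bracket (H a) (F a') = - iota (minc a' a) *: F a'.
Proof. by rewrite bracket_HE mincN rmorphN. Qed.

Lemma bracket_EF a : minuscule_root Psi a -> lie_bracket (E a) (F a) = H a.
Proof.
move=> aP; apply: b_ext => v vP; have aPN := minuscule_rootN aP.
rewrite [lie_bracket _ _]/(commutator _ _) !(add_lfunE, opp_lfunE, comp_lfunE).
rewrite H_b !EE_raise // !(mincN, mincNr).
rewrite minc_self ?(proj1 aP) // addrK subrK.
case: aP => _ /(_ v vP)[]; do 4?[case: eqP => ? /=; try (exfalso; lra)];
  by rewrite ?rmorphN1 ?rmorph0 ?rmorph1 ?scaleN1r ?scale0r ?scale1r ?sub0r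
    ?subr0 ?oppr0.
Qed.

(** Both E_a F_a' and F_a' E_a send b_v to b_(v + a - a') when c(v, a) = -1,
    c(v, a') = 1 and a, a' are orthogonal, and to 0 otherwise: as the numbers c
    of v lie in {-1, 0, 1}, negative values of c(a, a') leave no room. *)
Lemma bracket_EF0 a a' : minuscule_root Psi a -> minuscule_root Psi a' ->
  minc a a' <= 0 -> minc a' a <= 0 -> (minc a a' = 0 <-> minc a' a = 0) ->
  lie_bracket (E a) (F a') = 0.
Proof.
move=> aP a'P; have a'PN := minuscule_rootN a'P.
set x := minc a a'; set y := minc a' a => x0 y0 xy.
apply: b_ext => v vP.
rewrite [lie_bracket _ _]/(commutator _ _) !(add_lfunE, opp_lfunE, comp_lfunE).
rewrite !EE_raise // !(mincN, mincNr) -/x -/y lfunE /=.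
rewrite addrAC; set c := (_ && _); set d := (_ && _).
suff -> : c = d by rewrite subrr.
rewrite {}/c {}/d.
case: aP => _ /(_ v vP)[]; case: a'P => _ /(_ v vP)[];
apply/andP/andP => -[/eqP h1 /eqP h2]; split; apply/eqP; lra.
Qed.

Lemma E_sqr a : minuscule_root Psi a -> (E a \o E a)%VF = 0.
Proof.
move=> aP; apply: b_ext => v vP; rewrite comp_lfunE lfunE /= EE_raise //.
rewrite minc_self ?(proj1 aP) //.
by case: eqP => //= ->; case: eqP => // ?; exfalso; lra.
Qed.

Lemma bracket_EE a a' : minuscule_root Psi a -> minuscule_root Psi a' ->
  minc a a' = 0 -> minc a' a = 0 -> lie_bracket (E a) (E a') = 0.
Proof.
move=> aP a'P aa' a'a; apply: b_ext => v vP.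
rewrite [lie_bracket _ _]/(commutator _ _) !(add_lfunE, opp_lfunE, comp_lfunE).
by rewrite !EE_raise // aa' a'a !addr0 andbC addrAC subrr lfunE.
Qed.

(** If c(v, a) = -1 then c(v + a + a', a) = -1 + 2 - 1 = 0, so that E_a kills
    the vector obtained. *)
Lemma E_sandwich a a' : minuscule_root Psi a -> minuscule_root Psi a' ->
  minc a' a = -1 -> (E a \o E a' \o E a)%VF = 0.
Proof.
move=> aP a'P a'a; apply: b_ext => v vP; rewrite !comp_lfunE lfunE /=.
rewrite E_raise //; case: ifPn => [v1|_]; last by rewrite !linear0.
have vaP : v + a \in Psi by rewrite minuscule_raise.
rewrite EE_raise // [minc (v + a) a]mincD (eqP v1) minc_self ?(proj1 aP) // a'a.
by case: eqP => //= _; case: eqP => // ?; exfalso; lra.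
Qed.

(** Here k is the exponent 1 - A_ij of the relation: the operators commute for
    k = 1, and k = 2 is E_sandwich. From k = 3 on the relation follows from
    E_a E_a = 0 alone. *)
Lemma serre_E a a' (k : nat) : minuscule_root Psi a -> minuscule_root Psi a' ->
  (minc a a' = 0 <-> minc a' a = 0) -> minc a' a = 1 - k%:R -> (0 < k)%N ->
  iter k (lie_bracket (E a)) (E a') = 0.
Proof.
move=> aP a'P sym a'a.
have br2 : lie_bracket (E a) (lie_bracket (E a) (E a')) =
    - ((E a \o E a' \o E a)%VF *+ 2).
  rewrite [LHS]commutator2E E_sqr // -(comp_lfunA (E a')) E_sqr //.
  by rewrite comp_lfun0l comp_lfun0r sub0r mulr2n opprD.
have br3 : lie_bracket (E a) (lie_bracket (E a) (lie_bracket (E a) (E a'))) = 0.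
  rewrite br2 [LHS]/(commutator _ _) comp_lfunNr comp_lfunNl.
  rewrite mulr2n comp_lfunDr comp_lfunDl !comp_lfunA E_sqr // !comp_lfun0l.
  by rewrite -!comp_lfunA E_sqr // !comp_lfun0r addr0 subrr.
have br0 : lie_bracket (E a) 0 = 0 :> 'End(V).
  by rewrite [LHS]/(commutator _ _) comp_lfun0l comp_lfun0r subrr.
case: k a'a => [|[|[|k]]] // a'a _.
- by rewrite /= bracket_EE //; [apply/sym|]; rewrite a'a subrr.
- rewrite /= br2 E_sandwich ?mul0rn ?oppr0 //; rewrite a'a; lra.
- by rewrite !iterSr br3; elim: k {a'a} => //= k ->.
Qed.

Lemma serre_F a a' (k : nat) : minuscule_root Psi a -> minuscule_root Psi a' ->
  (minc a a' = 0 <-> minc a' a = 0) -> minc a' a = 1 - k%:R -> (0 < k)%N ->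
  iter k (lie_bracket (F a)) (F a') = 0.
Proof.
move=> /minuscule_rootN aP /minuscule_rootN a'P.
have mN u v : minc (- u) (- v) = minc u v by rewrite mincN mincNr opprK.
by rewrite -(mN a a') -(mN a' a); exact: serre_E.
Qed.

Theorem minuscule_operators_module (Delta : {fset 'rV[R]_n}) (m : nat)
    (a : 'I_m -> 'rV[R]_n) (A : 'M[int]_m) :
  minuscule Psi Delta -> (forall i, a i \in Delta) ->
  gcm A -> cartan_mx a = map_mx intr A ->
  exists rho : {linear kac_moody K A -> 'End(V)},
    lie_module rho /\
    forall i, [/\ rho (km_e K A i) = E (a i), rho (km_f K A i) = F (a i)
                & rho (km_h K A i) = H (a i)].
Proof.
move=> minP aD [_ A_le0 A_sym] aA.
have aP i : minuscule_root Psi (a i) by exact: minuscule_rootP (aD i).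
have aE i j : minc (a j) (a i) = (A i j)%:~R.
  have /matrixP/(_ i j) := aA; rewrite !mxE => <-.
  by rewrite /minc dotvC.
have aEC i j : iota (minc (a j) (a i)) = (A i j)%:~R.
  by rewrite aE rmorph_int.
have asym i j : minc (a i) (a j) = 0 <-> minc (a j) (a i) = 0.
  by rewrite !aE; split=> /eqP; rewrite intr_eq0 => /eqP/A_sym ->.
have aser i j : i != j -> minc (a j) (a i) = 1 - `|1 - A i j|%N%:R.
  move=> /A_le0 Aij; rewrite aE natr_absz ger0_norm ?subr_ge0 ?(le_trans Aij)
    //.
  by rewrite rmorphB /= opprB addrC subrK.
have apos i j : i != j -> (0 < `|1 - A i j|)%N.
  by move=> /A_le0 Aij; rewrite absz_gt0 subr_eq0 gt_eqF // (le_lt_trans Aij).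
apply: (@kac_moody_module K V m A (E \o a) (F \o a) (H \o a))
  => /= [i j|i j|i j|i|i j ij|i j ij|i j ij].
- exact: bracket_HH.
- by rewrite bracket_HE aEC.
- by rewrite bracket_HF aEC.
- exact: bracket_EF.
- by apply: bracket_EF0 => //; rewrite aE lerz0 A_le0 // eq_sym.
- by apply: serre_E => //; [exact: aser | exact: apos].
- by apply: serre_F => //; [exact: aser | exact: apos].
Qed.

(** An invariant subspace W, for roots a_i that admit a height function on Psi:
    every E_(a_i) decreases the height by one, distinct vectors have distinct
    heights, and every vector of positive height can be raised. *)
Section Invariant.
Context (m : nat) (a : 'I_m -> 'rV[R]_n) (ht : 'rV[R]_n -> nat).
Context (ht_raise : forall v i, v \in Psi -> v + a i \in Psi ->
  ht v = (ht (v + a i)).+1).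
Context (ht_inj : {in Psi &, injective ht}).
Context (ht_gt0 : forall v, v \in Psi -> (0 < ht v)%N ->
  exists i, v + a i \in Psi).

Context (W : {vspace V}).
Context (WE : forall i x, x \in W -> E (a i) x \in W).
Context (WF : forall i x, x \in W -> E (- a i) x \in W).

(** The sum ranges over translates of the vectors of Psi: applying E_(a_i) only
    changes the translation s into s + a_i and erases the terms that left Psi,
    so that no reindexing is needed. *)
Lemma invariant_highest k (c : Psi -> K) (s : 'rV[R]_n) :
  (exists2 u : Psi, val u + s \in Psi & c u != 0) ->
  (forall u : Psi, val u + s \in Psi -> c u != 0 -> (ht (val u + s) <= k)%N) ->
  \sum_(u : Psi) c u *: b (val u + s) \in W ->
  exists v, [/\ v \in Psi, ht v = 0%N & b v \in W].
Proof.
elim: k c s => [|k IHk] c s [u0 u0P cu0] c_ht sW.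
  have u0_ht : ht (val u0 + s) = 0%N by apply/eqP; rewrite -leqn0 c_ht.
  exists (val u0 + s); split=> //.
  suff sE : \sum_(u : Psi) c u *: b (val u + s) = c u0 *: b (val u0 + s).
    by rewrite -(scalerK cu0 (b _)) rpredZ // -sE.
  rewrite (bigD1 u0) //= big1 ?addr0 // => u uu0.
  have [uP|/b_notin ->] := boolP (val u + s \in Psi); last by rewrite scaler0.
  have [->|cu] := eqVneq (c u) 0; first by rewrite scale0r.
  case/negP: uu0; apply/eqP/val_inj/(addIr s)/ht_inj => //.
  by rewrite u0_ht; apply/eqP; rewrite -leqn0 c_ht.
(* If no term has height k + 1, the bound k already holds; otherwise a term of
   that height is raised. *)
have [[u [uP cu u_ht]]|no_top] := pselect (exists u : Psi,
    [/\ val u + s \in Psi, c u != 0 & ht (val u + s) = k.+1]); last first.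
  apply: (IHk c s) => //; first by exists u0.
  move=> u uP cu; have := c_ht u uP cu; rewrite leq_eqVlt => /orP[/eqP ku|//].
  by case: no_top; exists u.
have [|i uiP] := ht_gt0 uP; first by rewrite u_ht.
apply: (IHk (fun t : Psi => if val t + s \in Psi then c t else 0) (s + a i)).
- by exists u; rewrite ?addrA ?uP.
- move=> t; rewrite addrA => tiP; case: ifPn => [tP ct|]; last by rewrite eqxx.
  by rewrite -ltnS -ht_raise // c_ht.
- have := WE i sW; rewrite linear_sum; congr (_ \in W); apply: eq_bigr => t _.
  rewrite linearZ /= addrA; case: ifPn => [/E_b -> //|/b_notin ->].
  by rewrite linear0 scaler0 scale0r.
Qed.

Lemma invariant_full : W <> 0%VS -> W = fullv.
Proof.
move=> W0; have [v0 [v0P v0_ht v0W]] :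
    exists v, [/\ v \in Psi, ht v = 0%N & b v \in W].
  have w0 : vpick W != 0 by rewrite vpick0; apply/eqP.
  have [c wE] := b_span (vpick W).
  apply: (@invariant_highest (\max_(u : Psi) ht (val u)) c 0).
  - have [//|no_c] := pselect (exists2 u : Psi, val u + 0 \in Psi & c u != 0).
    case/eqP: w0; rewrite wE big1 // => u _.
    have [->|cu] := eqVneq (c u) 0; first by rewrite scale0r.
    by case: no_c; exists u; rewrite ?addr0 ?(valP u).
  - by move=> u _ _; rewrite addr0; exact: (leq_bigmax u).
  - under eq_bigr do rewrite addr0.
    by rewrite -wE memv_pick.
have bW k v : v \in Psi -> ht v = k -> b v \in W.
  elim: k v => [|k IHk] v vP v_ht; first by rewrite (ht_inj vP v0P) // v0_ht.
  have [|i viP] := ht_gt0 vP; first by rewrite v_ht.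
  rewrite -[v](addrK (a i)) -E_b //; apply: WF; apply: IHk => //.
  by have := ht_raise vP viP; rewrite v_ht => -[].
apply/eqP; rewrite eqEsubv subvf /=; apply/subvP => x _.
have [c ->] := b_span x; apply: memv_suml => u _.
by rewrite memvZ // (bW (ht (val u))) // (valP u).
Qed.
End Invariant.

End MinusculeOperators.

(** * The space with basis Psi and its operators *)

Lemma ffun_delta_sum (K : nzRingType) (T : finType) (x : {ffun T -> K^o}) :
  x = \sum_(u : T) x u *: [ffun t => (t == u)%:R].
Proof.
apply/ffunP => t; rewrite sum_ffunE (bigD1 t) //= !ffunE eqxx.
rewrite [_ *: _]mulr1 big1 ?addr0 // => u ut.
by rewrite !ffunE eq_sym (negPf ut) [_ *: _]mulr0.
Qed.

Section Operators.
Context (R : realType) (n : nat) (Psi : {fset 'rV[R]_n}).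
Implicit Types v a : 'rV[R]_n.
Local Notation V := (Vspace Psi).
Local Notation b v := (bvec Psi v).

Lemma bvec_notin v : v \notin Psi -> b v = 0.
Proof.
move=> vP; apply/ffunP => u; rewrite !ffunE.
by case: eqP => // uv; rewrite -uv (valP u) in vP.
Qed.

Lemma Vspace_decomp (x : V) :
  x = \sum_(u : Psi) (x : {ffun Psi -> R[i]^o}) u *: b (val u).
Proof.
by rewrite [LHS]ffun_delta_sum; apply: eq_bigr => u _; congr (_ *: _).
Qed.

Lemma lin_extE (g : Psi -> V) (u : Psi) : lin_ext g (b (val u)) = g u.
Proof.
rewrite lfunE /= /lin_ext_fun (bigD1 u) //= ffunE eqxx scale1r.
rewrite big1 ?addr0 // => t tu.
by rewrite ffunE (inj_eq val_inj) (negPf tu) scale0r.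
Qed.

Lemma opE_bvec a v : v \in Psi -> opE Psi a (b v) = b (v + a).
Proof.
move=> vP; rewrite (lin_extE _ [` vP]%fset) /=.
by case: ifPn => // /bvec_notin ->.
Qed.

Lemma opH_bvec a v : opH Psi a (b v) = (minc v a)%:C%C *: b v.
Proof.
have [vP|/bvec_notin ->] := boolP (v \in Psi); last by rewrite linear0 scaler0.
by rewrite (lin_extE _ [` vP]%fset).
Qed.

Lemma opF_opE a : opF Psi a = opE Psi (- a).
Proof. by []. Qed.

End Operators.

Theorem minuscule_module (R : realType) (n : nat)
    (Psi Delta : {fset 'rV[R]_n}) (m : nat)
    (a : 'I_m -> 'rV[R]_n) (A : 'M[int]_m) :
  minuscule Psi Delta -> (forall i, a i \in Delta) ->
  gcm A -> cartan_mx a = map_mx intr A ->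
  exists rho : {linear kac_moody R[i] A -> 'End(Vspace Psi)},
    lie_module rho /\ acts_by_operators a rho.
Proof.
apply: (@minuscule_operators_module R n Psi R[i] (real_complex R) (Vspace Psi)
  (bvec Psi) (opE Psi) (opH Psi)).
- exact: bvec_notin.
- by move=> x; exists x; exact: Vspace_decomp.
- exact: opE_bvec.
- exact: opH_bvec.
Qed.

Section MinusculeModuleTheory.
Context (R : realType) (n : nat) (Psi : {fset 'rV[R]_n}).
Context (m : nat) (A : 'M[int]_m) (a : 'I_m -> 'rV[R]_n).
Context (rho : {linear kac_moody R[i] A -> 'End(Vspace Psi)}).
Context (rhoP : acts_by_operators a rho).

Lemma bvec_neq0 v : v \in Psi -> bvec Psi v != 0.
Proof.
move=> vP; apply/eqP => /ffunP/(_ [` vP]%fset).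
by rewrite !ffunE eqxx; apply/eqP/oner_neq0.
Qed.

Theorem minuscule_irreducible (ht : 'rV[R]_n -> nat) :
  (exists v, v \in Psi) ->
  (forall v i, v \in Psi -> v + a i \in Psi -> ht v = (ht (v + a i)).+1) ->
  {in Psi &, injective ht} ->
  (forall v, v \in Psi -> (0 < ht v)%N -> exists i, v + a i \in Psi) ->
  lie_irreducible rho.
Proof.
move=> [v0 v0P] ht_raise ht_inj ht_gt0; split=> [V0|W WP].
  by have := bvec_neq0 v0P; rewrite -memv0 -V0 memvf.
have [W0|] := pselect (W = 0%VS); [by left | right].
apply: (@invariant_full R n Psi R[i] (Vspace Psi) (bvec Psi) (opE Psi)
  _ _ _ _ a ht) => //.
- exact: bvec_notin.
- by move=> x; exists x; exact: Vspace_decomp.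
- exact: opE_bvec.
- move=> i x xW; have [<- _ _] := rhoP i.
  exact: subvP (WP _) _ (memv_img _ xW).
- move=> i x xW; have [_ + _] := rhoP i; rewrite opF_opE => <-.
  exact: subvP (WP _) _ (memv_img _ xW).
Qed.

Lemma bvec_weight v : v \in Psi ->
  weight_vector rho (fun i => (minc v (a i))%:C%C) (bvec Psi v).
Proof.
move=> vP; split=> [|i]; first exact: bvec_neq0.
by have [_ _ ->] := rhoP i; exact: opH_bvec.
Qed.

Lemma bvec_highest v : v \in Psi -> (forall i, v + a i \notin Psi) ->
  highest_weight_vector rho (fun i => (minc v (a i))%:C%C) (bvec Psi v).
Proof.
move=> vP vaP; split=> [|i]; first exact: bvec_weight.
by have [-> _ _] := rhoP i; rewrite opE_bvec // bvec_notin.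
Qed.

Lemma bvec_lowest v : v \in Psi -> (forall i, v - a i \notin Psi) ->
  lowest_weight_vector rho (fun i => (minc v (a i))%:C%C) (bvec Psi v).
Proof.
move=> vP vaP; split=> [|i]; first exact: bvec_weight.
by have [_ -> _] := rhoP i; rewrite opF_opE opE_bvec // bvec_notin.
Qed.

Lemma dim_Vspace : \dim {: Vspace Psi} = #|` Psi|.
Proof. by rewrite dimvf /dim /= muln1 cardfE. Qed.

End MinusculeModuleTheory.

(** * Cartan matrices of types C_n^(1) and C_n *)

Section PrincipalSubmatrix.
Context (m p : nat) (f : 'I_p -> 'I_m) (A : 'M[int]_m).

Lemma gcm_mxsub : injective f -> gcm A -> gcm (mxsub f f A).
Proof.
move=> f_inj [A2 A_le0 A_sym]; split=> [i|i j ij|i j]; rewrite !mxE //.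
- by apply: A_le0; rewrite (inj_eq f_inj).
- exact: A_sym.
Qed.

Lemma diag_mx_unit (F : fieldType) (k : nat) (d : 'rV[F]_k) :
  (diag_mx d \in unitmx) = [forall i, d 0 i != 0].
Proof.
rewrite unitmxE det_diag unitfE; apply/idP/forallP => [/prodf_neq0 d0 i|d0].
  exact: d0.
by apply/prodf_neq0.
Qed.

Lemma symmetrizable_mxsub : symmetrizable A -> symmetrizable (mxsub f f A).
Proof.
move=> [D [B [D_unit B_sym AE]]]; exists (colsub f D), (mxsub f f B); split.
- rewrite !diag_mx_unit in D_unit *.
  by apply/forallP => i; rewrite mxE; apply: (forallP D_unit).
- by rewrite trmx_mxsub B_sym.
- apply/matrixP => i j; have /matrixP/(_ (f i) (f j)) := AE.
  by rewrite !mul_diag_mx !mxE.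
Qed.

End PrincipalSubmatrix.

(* Decides the equalities between indices, discarding the incompatible cases. *)
Ltac case_eqs := repeat (case: eqP => ? /=; try (exfalso; lia)).

Ltac lra_cases := case_eqs; cbn [nat_of_bool]; lra.

Section CartanC.
Context (n : nat) (hn : (2 <= n)%N).

Lemma gcm_C_affine : gcm (cartan_C_affine n).
Proof.
split=> [i|i j ij|i j]; rewrite !mxE ?eqxx //.
  by rewrite (negPf ij); do !case: ifP => _.
by rewrite -!val_eqE /=; case_eqs.
Qed.

Lemma symmetrizable_C_affine : symmetrizable (cartan_C_affine n).
Proof.
(* d i is proportional to 1 / a_i.a_i: the two end roots are the long ones. *)
pose d (i : nat) : rat := if (i == 0%N) || (i == n) then 1 else 2.
have d0 i : d i != 0 by rewrite /d; case: ifP.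
exists (\row_i d i),
  (\matrix_(i, j) ((d i)^-1 * (cartan_C_affine n i j)%:~R)); split.
- by rewrite diag_mx_unit; apply/forallP => i; rewrite mxE.
- apply/matrixP => i j; rewrite !mxE -!val_eqE /= /d.
  have ? := ltn_ord i; have ? := ltn_ord j; case_eqs; lra.
- by apply/matrixP => i j; rewrite mul_diag_mx !mxE mulVKf.
Qed.

Lemma cartan_C_mxsub :
  cartan_C n = mxsub (lift ord0) (lift ord0) (cartan_C_affine n).
Proof.
apply/matrixP => i j; rewrite !mxE (inj_eq lift_inj) /=.
by rewrite !/bump /= !add1n !eqSS.
Qed.

Lemma gcm_C : gcm (cartan_C n).
Proof.
by rewrite cartan_C_mxsub; apply: gcm_mxsub gcm_C_affine; exact: lift_inj.
Qed.

Lemma symmetrizable_C : symmetrizable (cartan_C n).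
Proof.
by rewrite cartan_C_mxsub; apply: symmetrizable_mxsub symmetrizable_C_affine.
Qed.

End CartanC.

(** * The minuscule system of type C *)

Section SystemC.
Context (R : realType) (n : nat) (hn : (2 <= n)%N).
Implicit Types v w : 'rV[R]_n.
Local Notation e k := (eps R n k).
Local Notation Psi := (PsiC R n).
Local Notation s := (@simpleC_affine R n).

Lemma dotv_eps (k : 'I_n) w : dotv (e k) w = w 0 k.
Proof.
rewrite /dotv (bigD1 k) //= mxE eqxx mul1r big1 ?addr0 // => j jk.
by rewrite mxE val_eqE (negPf jk) mul0r.
Qed.

Lemma dotv_eps2 (k l : nat) : (k < n)%N -> dotv (e k) (e l) = (k == l)%:R.
Proof. by move=> kn; rewrite (dotv_eps (Ordinal kn)) mxE. Qed.

Lemma dotv_simple (i : 'I_n.+1) w : dotv (s i) w =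
  if i == 0 :> nat then - (8 * dotv (e 0) w)
  else if i == n :> nat then 8 * dotv (e n.-1) w
  else 4 * (dotv (e i.-1) w - dotv (e i) w).
Proof.
rewrite /simpleC_affine; case: ifP => _; first by rewrite dotvNl dotvZl.
by case: ifP => _; rewrite dotvZl // dotvBl.
Qed.

Lemma dotv_eps_simple (k : nat) (i : 'I_n.+1) : (k < n)%N -> dotv (e k) (s i) =
  if i == 0 :> nat then - (8 * (k == 0%N)%:R)
  else if i == n :> nat then 8 * (k == n.-1)%:R
  else 4 * ((k == i.-1)%:R - (k == i)%:R).
Proof.
move=> kn; rewrite dotvC dotv_simple; have ? := ltn_ord i.
by case: eqP => [_|?]; last case: eqP => [_|?];
  rewrite !(dotvC _ (e k)) !dotv_eps2.
Qed.

Lemma dotv_simple2 (i j : 'I_n.+1) : dotv (s i) (s i) != 0 /\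
  2 * dotv (s i) (s j) = dotv (s i) (s i) * (cartan_C_affine n i j)%:~R.
Proof.
have ? := ltn_ord i; have ? := ltn_ord j.
rewrite !dotv_simple mxE -val_eqE /=.
case: (eqVneq (i : nat) 0%N) => [i0|/eqP i0]; 
  last case: (eqVneq (i : nat) n) => [iN|/eqP iN];
rewrite !dotv_eps_simple ?i0 ?iN; try lia; rewrite ?eqxx /=;
  by split; [apply/eqP|]; lra_cases.
Qed.

Lemma cartan_simpleC_affine : cartan_mx s = map_mx intr (cartan_C_affine n).
Proof.
apply/matrixP => i j; have [s0 sE] := dotv_simple2 i j.
by rewrite !mxE sE mulrC mulKf // mxE.
Qed.

Lemma cartan_simpleC : cartan_mx (@simpleC R n) = map_mx intr (cartan_C n).
Proof.
apply/matrixP => i j; rewrite cartan_C_mxsub.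
have /matrixP/(_ (lift ord0 i) (lift ord0 j)) := cartan_simpleC_affine.
by rewrite !mxE.
Qed.

Lemma PsiCP v : reflect
  (exists k : 'I_n, v = 4 *: e k \/ v = - (4 *: e k)) (v \in Psi).
Proof.
rewrite in_fsetU; apply: (iffP orP) => [[]/imfsetP[k _ ->]|[k [->|->]]].
- by exists k; left.
- by exists k; right.
- by left; apply: in_imfset.
- by right; apply: in_imfset.
Qed.

Lemma PsiC_in (k : nat) : (k < n)%N -> 4 *: e k \in Psi.
Proof. by move=> kn; apply/PsiCP; exists (Ordinal kn); left. Qed.

Lemma PsiCN v : (- v \in Psi) = (v \in Psi).
Proof.
have N w : w \in Psi -> - w \in Psi.
  by move=> /PsiCP[k [->|->]]; apply/PsiCP; exists k;
    [right|left; rewrite opprK].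
by apply/idP/idP => /N; rewrite ?opprK.
Qed.

Lemma PsiC_norm v : v \in Psi -> dotv v v = 16.
Proof.
move=> /PsiCP[k [->|->]]; rewrite !(dotvNl, dotvNr, dotvZl, dotvZr) ?opprK;
  rewrite dotv_eps2 // eqxx /=; lra.
Qed.

(** The reflection of v in a simple root maps v to v - c(v, a) a. *)
Lemma PsiC_reflection v (i : 'I_n.+1) : v \in Psi -> exists c : R,
  [/\ c = -1 \/ c = 0 \/ c = 1, 2 * dotv v (s i) = c * dotv (s i) (s i)
    & v - c *: s i \in Psi].
Proof.
have ? := ltn_ord i.
have pos (k : 'I_n) : exists c : R,
    [/\ c = -1 \/ c = 0 \/ c = 1,
        2 * dotv (4 *: e k) (s i) = c * dotv (s i) (s i)
      & 4 *: e k - c *: s i \in Psi].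
  have ? := ltn_ord k.
  rewrite dotvZl dotv_eps_simple // dotv_simple.
  case: (eqVneq (i : nat) 0%N) => [i0|/eqP i0]; 
  last case: (eqVneq (i : nat) n) => [iN|/eqP iN];
    rewrite !dotv_eps_simple ?i0 ?iN; try lia; rewrite ?eqxx /=.
  - have [k0|/eqP k0] := eqVneq (k : nat) 0%N.
      exists (-1); rewrite k0 -PsiCN; split; [by left|lra_cases|].
      suff -> : - (4 *: e 0 - -1 *: s i) = 4 *: e 0 by apply: PsiC_in; lia.
      rewrite /simpleC_affine i0 /=.
      by apply/rowP => j; rewrite !mxE; lra.
    exists 0; split; [by right; left|lra_cases|].
    by rewrite scale0r subr0 PsiC_in.
  - have [kN|/eqP kN] := eqVneq (k : nat) n.-1.
      exists 1; rewrite kN -PsiCN; split; [by right; right|lra_cases|].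
      suff -> : - (4 *: e n.-1 - 1 *: s i) = 4 *: e n.-1 by apply: PsiC_in; lia.
      rewrite /simpleC_affine iN eqxx; case: eqP => [?|_]; first by lia.
      by apply/rowP => j; rewrite !mxE; lra.
    exists 0; split; [by right; left|lra_cases|].
    by rewrite scale0r subr0 PsiC_in.
  - have [ki|/eqP ki] := eqVneq (k : nat) i.
      exists (-1); rewrite ki; split; [by left|lra_cases|].
      suff -> : 4 *: e i - -1 *: s i = 4 *: e i.-1 by apply: PsiC_in; lia.
      rewrite /simpleC_affine (introF eqP i0) (introF eqP iN).
      by apply/rowP => j; rewrite !mxE; lra.
    have [ki'|/eqP ki'] := eqVneq (k : nat) i.-1.
      exists 1; rewrite ki'; split; [by right; right|lra_cases|].
      suff -> : 4 *: e i.-1 - 1 *: s i = 4 *: e i by apply: PsiC_in; lia.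
      rewrite /simpleC_affine (introF eqP i0) (introF eqP iN).
      by apply/rowP => j; rewrite !mxE; lra.
    exists 0; split; [by right; left|lra_cases|].
    by rewrite scale0r subr0 PsiC_in.
(* The case of - 4 e_k follows by changing the sign of c. *)
move=> /PsiCP[k [->|->]]; have [c [cE ck cP]] := pos k; first by exists c.
exists (- c); split; last by rewrite -PsiCN opprB opprK scaleNr addrC.
  by case: cE => [|[|]] ->; rewrite ?opprK ?oppr0; tauto.
by rewrite dotvNl mulrN ck mulNr.
Qed.

Lemma minuscule_C_affine : minuscule Psi (DeltaC_affine R n).
Proof.
have s0 i : dotv (s i) (s i) != 0 by case: (dotv_simple2 i i).
split.
  apply/imfsetP => -[i _ si0]; have := s0 i; rewrite -si0.
  by rewrite dotvv_eq0 eqxx.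
move=> v _ vP /imfsetP[i _ ->]; have [c [cE vi viP]] := PsiC_reflection i vP.
(* If v + a lies in Psi, then |v + a|^2 = |v|^2 forces c = -1; similarly for
   v - a. *)
exists c; split=> //; split.
- move=> /PsiC_norm; rewrite dotvDl !dotvDr (dotvC (s i) v) (PsiC_norm vP) => h.
  apply: (mulIf (s0 i)); rewrite -vi; lra.
- by move=> c1; move: viP; rewrite c1 scaleN1r opprK.
- move=> /PsiC_norm; rewrite dotvBl !dotvBr (dotvC (s i) v) (PsiC_norm vP) => h.
  apply: (mulIf (s0 i)); rewrite -vi; lra.
- by move=> c1; move: viP; rewrite c1 scale1r.
Qed.

Lemma card_PsiC : #|` Psi| = (2 * n)%N.
Proof.
have e_inj : injective (fun k : 'I_n => 4 *: e k).
  move=> k l kl; have := congr1 (fun v => dotv (e k) v) kl.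
  rewrite /= !dotvZr !dotv_eps2 // eqxx => h; apply/val_inj/eqP.
  by move: h; clear kl; case: eqP => //= _ h; exfalso; lra.
rewrite cardfsU; set I := (X in (_ - #|` X|)%N); suff -> : I = fset0.
  rewrite cardfs0 subn0 !card_imfset //=; last by move=> k l /oppr_inj/e_inj.
  by rewrite -cardE card_ord addnn mul2n.
apply/fsetP => v; rewrite in_fset0 in_fsetI; apply/andP => -[].
move=> /imfsetP[k _ ->] /imfsetP[l _ kl].
have := congr1 (fun v => dotv (e k) v) kl.
rewrite /= !(dotvNr, dotvZr) !dotv_eps2 // eqxx; clear kl.
by case: eqP => /= _; lra.
Qed.

(** The vector whose scalar product with each of the n finite simple roots is 1:
    its k-th coordinate is (2 (n - k) - 1) / 8. *)
Definition rhoC : 'rV[R]_n := \row_k ((n - k)%:R / 4 - 8^-1).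
(** The number of simple roots in 4 e_0 - v, for v in Psi, that is the position
    of v in the chain from 4 e_0 to - 4 e_0. The truncation is harmless on Psi,
    by heightCE. *)
Definition heightC v : nat := Num.truncn (dotv (4 *: e 0 - v) rhoC).

Lemma dotv_eps_rhoC (k : nat) : (k < n)%N ->
  dotv (e k) rhoC = (n%:R - k%:R) / 4 - 8^-1.
Proof. by move=> kn; rewrite (dotv_eps (Ordinal kn)) mxE natrB // ltnW. Qed.

Lemma heightC_pos (k : nat) : (k < n)%N -> heightC (4 *: e k) = k.
Proof.
move=> kn; rewrite /heightC dotvBl !dotvZl !dotv_eps_rhoC //; last by lia.
rewrite -[RHS](@natrK R); congr Num.truncn; lra.
Qed.

Lemma heightC_neg (k : nat) : (k < n)%N ->
  heightC (- (4 *: e k)) = (2 * n - k.+1)%N.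
Proof.
move=> kn; rewrite /heightC opprK dotvDl !dotvZl !dotv_eps_rhoC //; last by lia.
rewrite -[RHS](@natrK R); congr Num.truncn.
rewrite natrB; last by lia.
rewrite natrM -[k.+1%:R]natr1; lra.
Qed.

Lemma heightCE v : v \in Psi -> (heightC v)%:R = dotv (4 *: e 0 - v) rhoC.
Proof.
have n0 : (0 < n)%N by lia.
move=> /PsiCP[k [->|->]]; rewrite ?heightC_pos ?heightC_neg //;
  rewrite dotvBl ?dotvNl !dotvZl !dotv_eps_rhoC //; first by lra.
rewrite natrB; last by have := ltn_ord k; lia.
rewrite natrM -[k.+1%:R]natr1; lra.
Qed.

Lemma dotv_simpleC_rhoC (i : 'I_n) : dotv (simpleC R i) rhoC = 1.
Proof.
have ? := ltn_ord i.
rewrite /simpleC dotv_simple /= /bump add1n /=.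
case: eqP => [iN|?]; rewrite !dotv_eps_rhoC; try lia.
  have -> : n%:R = n.-1%:R + 1 :> R by rewrite natr1 prednK //; lia.
  lra.
rewrite add0n -[i.+1%:R]natr1; lra.
Qed.

Lemma heightC_raise v i : v \in Psi -> v + simpleC R i \in Psi ->
  heightC v = (heightC (v + simpleC R i)).+1.
Proof.
move=> vP viP; apply/eqP; rewrite -(eqr_nat R) -addn1 natrD !heightCE //.
by rewrite opprD addrA [dotv (_ - simpleC R i) _]dotvBl dotv_simpleC_rhoC subrK.
Qed.

Lemma heightC_inj : {in Psi &, injective heightC}.
Proof.
move=> v w /PsiCP[k kE] /PsiCP[l lE]; have ? := ltn_ord k; have ? := ltn_ord l.
case: kE lE => -> [] ->; rewrite ?heightC_pos ?heightC_neg // => kl; try lia.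
- by rewrite kl.
- by have -> : (k : nat) = l by lia.
Qed.

Lemma simpleC_mid (i : 'I_n) : i.+1 != n -> simpleC R i = alpha R n i.+1.
Proof.
by move=> iN; rewrite /simpleC /simpleC_affine /= /bump add1n /= (negPf iN).
Qed.

Lemma simpleC_last (i : 'I_n) : i.+1 = n -> simpleC R i = alpha''n R n.
Proof.
by move=> iN; rewrite /simpleC /simpleC_affine /= /bump add1n /= iN eqxx.
Qed.

Lemma heightC_gt0 v : v \in Psi -> (0 < heightC v)%N ->
  exists i, v + simpleC R i \in Psi.
Proof.
move=> /PsiCP[k [->|->]]; rewrite ?heightC_pos ?heightC_neg // => k0.
  have kn : (k.-1 < n)%N by have := ltn_ord k; lia.
  exists (Ordinal kn); rewrite simpleC_mid /=; last by have := ltn_ord k; lia.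
  suff -> : 4 *: e k + alpha R n k.-1.+1 = 4 *: e k.-1 by exact: PsiC_in.
  by rewrite prednK //; apply/rowP => j; rewrite !mxE; lra.
exists k; have [kN|kN] := eqVneq k.+1 n.
  rewrite simpleC_last //.
  suff -> : - (4 *: e k) + alpha''n R n = 4 *: e k by exact: PsiC_in.
  have nk : n.-1 = k by lia.
  by rewrite /alpha''n nk; apply/rowP => j; rewrite !mxE; lra.
rewrite simpleC_mid // -PsiCN.
suff -> : - (- (4 *: e k) + alpha R n k.+1) = 4 *: e k.+1.
  by apply: PsiC_in; have := ltn_ord k; lia.
by apply/rowP => j; rewrite !mxE; lra.
Qed.

(** The weight of the top of the chain is the first fundamental weight. *)
Lemma minc_top (i : 'I_n) : minc (4 *: e 0) (simpleC R i) = (i == 0 :> nat)%:R.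
Proof.
have n0 : (0 < n)%N by lia.
have ? := ltn_ord i.
have [s0 _] := dotv_simple2 (lift ord0 i) (lift ord0 i).
apply: (mulIf s0); rewrite /minc divfK //.
rewrite dotvZl dotv_eps_simple // dotv_simple /= /bump add1n /=.
case: (eqVneq i.+1 n) => [iN|iN]; rewrite !dotv_eps_simple ?eqxx /=; try lia.
all: rewrite /bump add1n /= ?iN; lra_cases.
Qed.

End SystemC.

Theorem proposition6p4 (R : realType) (n : nat) (hn : (2 <= n)%N) :
  [/\ \dim {: Vspace (PsiC R n)} = (2 * n)%N,
      gcm (cartan_C_affine n) /\ symmetrizable (cartan_C_affine n),
      cartan_mx (@simpleC_affine R n) = map_mx intr (cartan_C_affine n)
    & exists rho : {linear kac_moody R[i] (cartan_C_affine n)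
                      -> 'End(Vspace (PsiC R n))},
        lie_module rho /\ acts_by_operators (@simpleC_affine R n) rho]
  /\
  [/\ minuscule (PsiC R n) (DeltaC R n),
      gcm (cartan_C n) /\ symmetrizable (cartan_C n),
      cartan_mx (@simpleC R n) = map_mx intr (cartan_C n)
    & exists rho : {linear kac_moody R[i] (cartan_C n)
                      -> 'End(Vspace (PsiC R n))},
        [/\ lie_module rho /\ acts_by_operators (@simpleC R n) rho,
            lie_irreducible rho,
            exists lam, highest_weight_vector rho lam
                          (bvec (PsiC R n) (4 *: eps R n 0)),
            exists lam, lowest_weight_vector rho lam
                          (bvec (PsiC R n) (- (4 *: eps R n 0)))
          & affords_natural_C rho]].
Proof.
have dimV : \dim {: Vspace (PsiC R n)} = (2 * n)%N.
  by rewrite dim_Vspace card_PsiC.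
have minP := minuscule_C_affine R hn.
have sD i : simpleC_affine R i \in DeltaC_affine R n by exact: in_imfset.
split; split=> //.
- by split; [exact: gcm_C_affine | exact: symmetrizable_C_affine].
- exact: cartan_simpleC_affine.
- apply: minuscule_module minP sD _ _; first exact: gcm_C_affine.
  exact: cartan_simpleC_affine.
- exact: minuscule_sub (fsubD1set _ _) minP.
- by split; [exact: gcm_C | exact: symmetrizable_C].
- exact: cartan_simpleC.
have [rho [rho_mod rhoP]] := minuscule_module minP (fun i => sD (lift ord0 i))
  (gcm_C hn) (cartan_simpleC R hn).
have top_in : 4 *: eps R n 0 \in PsiC R n by apply: PsiC_in; lia.
have irr : lie_irreducible rho.
  apply: (minuscule_irreducible rhoP (ht := @heightC R n)).
  - by exists (4 *: eps R n 0).
  - exact: heightC_raise.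
  - exact: heightC_inj.
  - exact: heightC_gt0.
have sP i := minuscule_rootP minP (sD (lift ord0 i)).
have high : highest_weight_vector rho (fundamental_weight R[i] 1)
    (bvec (PsiC R n) (4 *: eps R n 0)).
  have -> : fundamental_weight R[i] 1 =
      fun i : 'I_n => (minc (4 *: eps R n 0) (simpleC R i))%:C%C.
    by apply/funext => i; rewrite minc_top // rmorph_nat.
  apply: (bvec_highest rhoP) => // i.
  rewrite minuscule_raise // minc_top //.
  by apply/eqP; case: eqP => /= _; lra.
exists rho; split=> //.
- by exists (fundamental_weight R[i] 1).
- eexists; apply: (bvec_lowest rhoP) => [|i]; first by rewrite PsiCN.
  rewrite minuscule_raise ?PsiCN //; last exact: minuscule_rootN.
  rewrite mincN mincNr opprK minc_top //.
  by apply/eqP; case: eqP => /= _; lra.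
- by split=> //; split=> //; exists (bvec (PsiC R n) (4 *: eps R n 0)).
Qed.
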